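(* Let $A=(a_{k,j})$ be a real symmetric positive semi-definite $n\times n$ matrix with columns $\mathbf{a}_1,\dots,\mathbf{a}_n$, and define $$\mathcal{K}_H^{j}:=\frac{\|\mathbf{a}_j\|^2-a_{j,j}^2}{a_{j,j}^2}=\sum_{k\ne j}a_{k,j}^2\,/\,a_{j,j}^2,\qquad \mathcal{K}_H:=\max_{1\le j\le n}\mathcal{K}_H^{j},$$ with the convention $\mathcal{K}_H^j:=0$ if $a_{j,j}=0$. Let $0<\varepsilon<1$ and $0<\delta<1$. If the positive integer $N$ satisfies $$N>2\,\mathcal{K}_H\,\varepsilon^{-2}\ln(2/\delta),$$ then the Hutchinson trace estimator $tr_H^N(A)$ satisfies $$\Pr\left(\,|tr_H^N(A)-tr(A)|\le \varepsilon\, tr(A)\,\right)\ \ge\ 1-\delta .$$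
   Context: $tr(A)$ denotes the trace of $A$ and $\|\cdot\|$ the Euclidean norm. The Hutchinson estimator is $tr_H^N(A):=\frac1N\sum_{i=1}^N w_i^t A w_i$, where $w_1,\dots,w_N\in\mathbb{R}^n$ are independent random vectors, $w_i=(w_{i1},\dots,w_{in})^t$, and all components $w_{ij}$ are i.i.d. Rademacher random variables: $\Pr(w_{ij}=1)=\Pr(w_{ij}=-1)=\tfrac12$. *)

(* Defs.v *)
From mathcomp Require Export all_boot all_order all_algebra.
From mathcomp Require Export all_classical all_reals all_analysis.
Export Order.TTheory GRing.Theory Num.Theory.
Export numFieldNormedType.Exports.

Set Implicit Arguments.
Unset Strict Implicit.
Unset Printing Implicit Defensive.

Local Open Scope classical_set_scope.
Local Open Scope ring_scope.

Definition possemidef (R : realType) (n : nat) (A : 'M[R]_n) : Prop :=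
  forall x : 'cV[R]_n, 0 <= (x^T *m A *m x) 0 0.

(* The library's norm on matrices is the sup norm, hence this definition. *)
Definition eucl_norm (R : realType) (n : nat) (v : 'cV[R]_n) : R :=
  Num.sqrt (\sum_(k < n) v k 0 ^+ 2).

Definition KHj (R : realType) (n : nat) (A : 'M[R]_n) (j : 'I_n) : R :=
  if A j j == 0 then 0
  else (eucl_norm (col j A) ^+ 2 - A j j ^+ 2) / A j j ^+ 2.

(* Every [KHj A j] is nonnegative, so the default value 0 does not affect
   the maximum. *)
Definition KH (R : realType) (n : nat) (A : 'M[R]_n) : R :=
  \big[Num.max/0]_(j < n) KHj A j.

Definition tr_hutchinson (R : realType) (n N : nat) (A : 'M[R]_n)
    (w : 'I_N -> 'cV[R]_n) : R :=
  N%:R^-1 * \sum_(i < N) ((w i)^T *m A *m w i) 0 0.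

Definition rademacher (d : measure_display) (T : measurableType d)
    (R : realType) (P : probability T R) (X : {RV P >-> R}) : Prop :=
  P (X @^-1` [set 1]) = (2^-1)%:E /\ P (X @^-1` [set -1]) = (2^-1)%:E.

Definition mutually_independent (d : measure_display) (T : measurableType d)
    (R : realType) (P : probability T R) (I : finType)
    (X : I -> {RV P >-> R}) : Prop :=
  forall (J : {set I}) (B : I -> set R), (forall i, measurable (B i)) ->
    P (\bigcap_(i in [set` J]) (X i @^-1` B i)) =
    (\prod_(i in J) P (X i @^-1` B i))%E.

(* Main.v *)
Require Import Defs.
From mathcomp Require Import ring lra measurable_realfun.

Local Open Scope classical_set_scope.
Local Open Scope ring_scope.

(** The proof is a Chernoff bound in which convexity of the exponential decouples
the columns of [A].

For a sign vector [x], the diagonal of [A] contributes exactly [\tr A] to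
[x^T A x], because [x_j ^ 2 = 1].  When [\tr A > 0], the relative error of one
sample is therefore
  [sum_j (a_jj / tr A) * (x_j * sum_(k != j) (a_kj / a_jj) * x_k)],
a convex combination, since a positive semi-definite [A] has [a_jj >= 0], and
[a_jj = 0] forces the whole column to vanish ([rel_errorE]).  By Jensen's
inequality, the exponential moment of the relative error is at most the weighted
mean of the exponential moments of the brackets.  In the bracket of index [j],
the products [x_j x_k] with [k != j] are again independent random signs, so
[cosh v <= exp (v ^ 2 / 2)] bounds its exponential moment at [u] by
[exp (u ^ 2 * KHj A j / 2)]; this is where the off-diagonal column norms come
from.  Hence the exponential moment of the relative error is at most
[exp (u ^ 2 * K / 2)] for every [K >= KH A] ([sum_expR_rel_error]), and that of
the sum of the errors of [N] samples is at most the [N]-th power of this.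
Markov's inequality, applied to each of the two tails with the optimal [u],
bounds the probability of each by [delta / 2] ([card_inaccurate_le]).

Taking for [K] the value [N * eps ^ 2 / (2 * ln (2 / delta))], for which the
hypothesis on [N] says [KH A < K], rather than [KH A] itself, avoids dividing by
[KH A], which may be zero.  If [\tr A = 0] then [A = 0], and the estimator is
exact.

Finitely many signs are involved, so every expectation above is written as a sum
over all sign patterns [s : {ffun I -> bool}], the boolean [b] standing for the
sign [(-1) ^+ b].  The random variables of the statement enter only through
[prob_ge_of_sign_events]: independent Rademacher variables give each of the
[2 ^ #|I|] patterns the same probability, so an upper bound on the number of
inaccurate patterns is a lower bound on the probability of accuracy. *)

(** * Inequalities for the exponential *)

Lemma le_at0_of_derive_le0 {R : realType} (f f' : R -> R) :
  (forall y : R, is_derive y 1 f (f' y)) -> (forall y, 0 < y -> f' y <= 0) ->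
  forall x, 0 <= x -> f x <= f 0.
Proof.
move=> df f'_le0 x x_ge0.
have dble (y : R) : derivable f y 1 by case: (df y).
apply: (@ler0_derive1_nincry _ f 0) => //.
- move=> y; rewrite in_itv/= andbT => y_gt0.
  by rewrite derive1E; case: (df y) => _ ->; exact: f'_le0.
- apply: continuous_subspaceT => y; apply: differentiable_continuous.
  exact/derivable1_diffP.
Qed.

(** This is [cosh x <= exp (x ^ 2 / 2)].  The derivative of
[exp (- y ^ 2 / 2) * cosh y] has the sign of [sinh y - y * cosh y], which is
nonpositive for [y >= 0] because its own derivative is [- y * sinh y]. *)
Lemma expR_addN_le {R : realType} (x : R) :
  expR x + expR (- x) <= 2 * expR (x ^+ 2 / 2).
Proof.
wlog x_ge0 : x / 0 <= x.
  move=> H; have [/H//|x_lt0] := leP 0 x.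
  by rewrite -[x in expR x]opprK addrC -sqrrN; apply: H; lra.
(* h y / 2 is sinh y - y * cosh y. *)
pose h (y : R) := (1 - y) * expR y - (1 + y) * expR (- y).
have h_le0 (y : R) : 0 <= y -> h y <= 0.
  move=> y0; have <- : h 0 = 0 by rewrite /h oppr0 expR0; ring.
  apply: (@le_at0_of_derive_le0 _ h (fun z => z * (expR (- z) - expR z))) => //.
  - by move=> z; rewrite /h; apply: is_derive_eq; rewrite /GRing.scale /=; ring.
  - by move=> z z0; rewrite mulr_ge0_le0 ?(ltW z0)// subr_le0 ler_expR; lra.
pose g (y : R) := expR (- (y ^+ 2 / 2)) * (expR y + expR (- y)).
have : g x <= g 0.
  apply: (@le_at0_of_derive_le0 _ g
    (fun z => expR (- (z ^+ 2 / 2)) * h z)) => //.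
  - move=> z; rewrite /g; apply: is_derive_eq.
    by rewrite /GRing.scale /= /h; field.
  - by move=> z z0; rewrite mulr_ge0_le0 ?expR_ge0// h_le0// ltW.
rewrite /g expr0n mul0r oppr0 expR0 mul1r expRN mulrC ler_pdivrMr ?expR_gt0//.
Qed.

(** Jensen's inequality: [exp] lies above its tangent line at the barycentre [m],
and the weighted mean of the tangent line is [exp m]. *)
Lemma expR_convex_sum {R : realType} {I : finType} (l z : I -> R) :
  (forall i, 0 <= l i) -> \sum_i l i = 1 ->
  expR (\sum_i l i * z i) <= \sum_i l i * expR (z i).
Proof.
move=> l_ge0 l_sum1; set m := \sum_i l i * z i.
have -> : expR m = \sum_i l i * (expR m * (1 + (z i - m))).
  under eq_bigr do rewrite mulrCA mulrDr mulr1 mulrBr.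
  rewrite -mulr_sumr big_split/= sumrB -mulr_suml l_sum1 -/m; ring.
apply: ler_sum => i _; rewrite ler_wpM2l//.
by rewrite -ler_pdivlMl ?expR_gt0// -expRN -expRD [- m + _]addrC expR_ge1Dx.
Qed.

(** * Exponential moments of random signs *)

(** The exponential of the sum is a product over the indices, so the sum over all
patterns factors into one hyperbolic cosine per index. *)
Lemma sum_expR_signs {R : realType} {I : finType} (c : I -> R) :
  \sum_(s : {ffun I -> bool}) expR (\sum_k c k * (-1) ^+ s k)
  <= 2 ^+ #|I| * expR ((\sum_k c k ^+ 2) / 2).
Proof.
under eq_bigr do rewrite expR_sum.
rewrite -(bigA_distr_bigA (fun k (b : bool) => expR (c k * (-1) ^+ b))) /=.
rewrite mulr_suml expR_sum -[2 ^+ _]prodr_const -big_split/=.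
apply: ler_prod => k _; rewrite big_bool/= expr0 expr1 mulrN !mulr1.
by rewrite addr_ge0 ?expR_ge0// addrC expR_addN_le.
Qed.

(** Multiplies every sign other than the [j]-th by the [j]-th sign.  As an
involution of the patterns it preserves the uniform distribution, and it turns
the products of the [j]-th sign with the others into independent signs. *)
Definition flip_others {I : finType} (j : I) (s : {ffun I -> bool}) :
    {ffun I -> bool} :=
  [ffun k => if k == j then s j else s k (+) s j].

Lemma flip_othersK {I : finType} (j : I) : involutive (flip_others j).
Proof.
move=> s; apply/ffunP => k; rewrite !ffunE eqxx.
by case: eqVneq => [->//|_]; rewrite -addbA addbb addbF.
Qed.

Lemma sum_expR_signs_row {R : realType} {I : finType} (j : I) (c : I -> R) :
  \sum_(s : {ffun I -> bool})
     expR ((-1) ^+ s j * \sum_(k | k != j) c k * (-1) ^+ s k)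
  <= 2 ^+ #|I| * expR ((\sum_(k | k != j) c k ^+ 2) / 2).
Proof.
rewrite (reindex_inj (can_inj (flip_othersK j)))/=.
pose c' k := if k != j then c k else 0.
have -> : \sum_(k | k != j) c k ^+ 2 = \sum_k c' k ^+ 2.
  rewrite big_mkcond/=; apply: eq_bigr => k _; rewrite /c'.
  by case: eqP => //=; rewrite expr0n.
apply: le_trans (sum_expR_signs c').
apply: ler_sum => s _; rewrite ler_expR mulr_sumr big_mkcond/=.
apply: ler_sum => k _; rewrite /c' !ffunE eqxx.
case: eqVneq => [_|_]/=; first by rewrite mul0r.
by rewrite signr_addb mulrC -!mulrA -expr2 sqrr_sign mulr1.
Qed.

(** Independence of the rows of a uniformly distributed pattern. *)
Lemma sum_prod_rows {R : realType} {I J : finType} (F : {ffun J -> bool} -> R) :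
  \sum_(s : {ffun I * J -> bool}) \prod_i F [ffun j => s (i, j)]
  = (\sum_s F s) ^+ #|I|.
Proof.
rewrite -prodr_const bigA_distr_bigA/=.
pose uncurry (f : {ffun I -> {ffun J -> bool}}) : {ffun I * J -> bool} :=
  [ffun ij => f ij.1 ij.2].
pose curry (s : {ffun I * J -> bool}) : {ffun I -> {ffun J -> bool}} :=
  [ffun i => [ffun j => s (i, j)]].
rewrite (reindex uncurry)/=; last first.
  exists curry => s _.
    by apply/ffunP => i; rewrite ffunE; apply/ffunP => j; rewrite !ffunE.
  by apply/ffunP => -[i j]; rewrite !ffunE.
apply: eq_bigr => f _; apply: eq_bigr => i _; congr (F _).
by apply/ffunP => j; rewrite !ffunE.
Qed.

(** Chernoff's form of Markov's inequality for the counting measure: each [s] with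
[a < f s] contributes at least 1 to the sum of the [expR (u * (f s - a))]. *)
Lemma card_gt_le_expR {R : realType} {S : finType} (f : S -> R) (a u : R) :
  0 <= u ->
  #|[pred s | a < f s]|%:R <= expR (- (u * a)) * \sum_s expR (u * f s).
Proof.
move=> u_ge0; rewrite -sum1_card natr_sum mulr_sumr [leLHS]big_mkcond/=.
apply: ler_sum => s _; rewrite -expRD inE.
case: ifPn => [fs|_]; last exact: expR_ge0.
rewrite -[leLHS]expR0 ler_expR addrC -mulrBr mulr_ge0// subr_ge0; exact: ltW.
Qed.

(** * Positive semi-definite matrices *)

Lemma quad_formE {R : realType} {n : nat} (A : 'M[R]_n) (x : 'cV[R]_n) :
  (x^T *m A *m x) 0 0 = \sum_j x j 0 * \sum_k A k j * x k 0.
Proof.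
rewrite mxE; apply: eq_bigr => j _; rewrite mxE mulrC; congr (_ * _).
by apply: eq_bigr => k _; rewrite mxE mulrC.
Qed.

Lemma quad_form_delta {R : realType} {n : nat} (A : 'M[R]_n) (j k : 'I_n) :
  ((delta_mx k 0 : 'cV_n)^T *m A *m (delta_mx j 0 : 'cV_n)) 0 0 = A k j.
Proof. by rewrite trmx_delta -rowE -colE !mxE. Qed.

Lemma possemidef_diag_ge0 {R : realType} {n : nat} (A : 'M[R]_n) :
  possemidef A -> forall j, 0 <= A j j.
Proof. by move=> A_psd j; rewrite -quad_form_delta; exact: A_psd. Qed.

(** If [a_jj = 0] then the quadratic form at [e_k + y e_j] is affine in [y] with
slope [2 * a_kj], so it can stay nonnegative only if [a_kj = 0]. *)
Lemma possemidef_col0 {R : realType} {n : nat} (A : 'M[R]_n) :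
  A^T = A -> possemidef A -> forall j, A j j = 0 -> forall k, A k j = 0.
Proof.
move=> A_sym A_psd j Ajj k; apply/eqP/negPn/negP => Akj.
have entryD (B C : 'M[R]_1) : (B + C) 0 0 = B 0 0 + C 0 0 by rewrite mxE.
have entryZ a (B : 'M[R]_1) : (a *: B) 0 0 = a * B 0 0 by rewrite mxE.
have Ajk : A j k = A k j by rewrite -[in LHS]A_sym mxE.
(* The quadratic form at e_k + y e_j is a_kk + 2 * y * a_kj, here equal to -1. *)
pose y := - (A k k + 1) / (2 * A k j).
have := A_psd (delta_mx k 0 + y *: delta_mx j 0).
rewrite [_^T]linearD/= [(y *: _)^T]linearZ/= !mulmxDl !mulmxDr.
rewrite -!scalemxAl -!scalemxAr.
rewrite !(entryD, entryZ) !quad_form_delta.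
rewrite Ajj Ajk.
have -> : A k k + y * A k j + (y * A k j + y * (y * 0)) = -1.
  by rewrite /y; field.
lra.
Qed.

Lemma possemidef_tr0 {R : realType} {n : nat} (A : 'M[R]_n) :
  A^T = A -> possemidef A -> \tr A = 0 -> A = 0.
Proof.
move=> A_sym A_psd /eqP; rewrite psumr_eq0; last first.
  by move=> j _; exact: possemidef_diag_ge0.
move=> /allP trA0; apply/matrixP => k j; rewrite mxE.
apply: possemidef_col0 => //; apply/eqP; apply: trA0.
by rewrite mem_index_enum.
Qed.

(** No case distinction remains, since division by zero gives zero and thereby
agrees with the convention for [A j j = 0]. *)
Lemma KHjE {R : realType} {n : nat} (A : 'M[R]_n) (j : 'I_n) :
  KHj A j = \sum_(k | k != j) (A k j / A j j) ^+ 2.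
Proof.
rewrite /KHj; case: eqP => [->|/eqP Ajj].
  by rewrite big1// => k _; rewrite invr0 mulr0 expr0n.
rewrite /eucl_norm sqr_sqrtr; last by apply: sumr_ge0 => k _; exact: sqr_ge0.
rewrite (bigD1 j)//= mxE [X in X - _]addrC addrK mulr_suml.
by apply: eq_bigr => k _; rewrite mxE expr_div_n.
Qed.

Lemma KHj_le_KH {R : realType} {n : nat} (A : 'M[R]_n) (j : 'I_n) :
  KHj A j <= KH A.
Proof. exact: le_bigmax. Qed.

(** * The relative error of the estimator on sign vectors *)

Definition sign_vector (R : realType) (n : nat) (s : {ffun 'I_n -> bool}) :
    'cV[R]_n := \col_j (-1) ^+ s j.

Definition rel_error {R : realType} {n : nat} (A : 'M[R]_n)
    (s : {ffun 'I_n -> bool}) : R :=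
  (((sign_vector R n s)^T *m A *m sign_vector R n s) 0 0 - \tr A) / \tr A.

(** The weights [A j j / \tr A] are nonnegative and sum to 1, which prepares
Jensen's inequality.  Factoring [A j j] out of column [j] is legitimate even when
it is zero, by [possemidef_col0]. *)
Lemma rel_errorE {R : realType} {n : nat} (A : 'M[R]_n)
    (s : {ffun 'I_n -> bool}) :
  A^T = A -> possemidef A ->
  rel_error A s = \sum_j (A j j / \tr A) *
    ((-1) ^+ s j * \sum_(k | k != j) (A k j / A j j) * (-1) ^+ s k).
Proof.
move=> A_sym A_psd; rewrite /rel_error quad_formE [X in _ - X]/mxtrace.
rewrite -sumrB mulr_suml; apply: eq_bigr => j _.
rewrite mulrAC; congr (_ / _).
rewrite (bigD1 j)//= !mxE mulrDr mulrCA -expr2 sqrr_sign mulr1 addrC addrA.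
rewrite addNr add0r mulrCA; congr (_ * _); rewrite mulr_sumr.
apply: eq_bigr => k _; rewrite mxE mulrA; congr (_ * _).
have [Ajj|Ajj] := eqVneq (A j j) 0; last by rewrite mulrC divfK.
by rewrite Ajj mul0r possemidef_col0.
Qed.

(** Jensen's inequality reduces the claim to a single column [j], where
[sum_expR_signs_row] gives the exponent [u ^ 2 * KHj A j / 2]. *)
Lemma sum_expR_rel_error {R : realType} {n : nat} (A : 'M[R]_n) (K u : R) :
  A^T = A -> possemidef A -> 0 < \tr A -> KH A <= K ->
  \sum_s expR (u * rel_error A s) <= 2 ^+ n * expR (u ^+ 2 * K / 2).
Proof.
move=> A_sym A_psd trA_gt0 KH_le.
have wt_ge0 j : 0 <= A j j / \tr A.
  by rewrite divr_ge0 ?possemidef_diag_ge0 ?(ltW trA_gt0).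
have wt_sum1 : \sum_j A j j / \tr A = 1.
  by rewrite -mulr_suml divff// gt_eqF.
pose z j (s : {ffun 'I_n -> bool}) : R :=
  (-1) ^+ s j * \sum_(k | k != j) (u * (A k j / A j j)) * (-1) ^+ s k.
have -> : \sum_s expR (u * rel_error A s) =
          \sum_s expR (\sum_j A j j / \tr A * z j s).
  apply: eq_bigr => s _; rewrite rel_errorE// mulr_sumr; congr expR.
  apply: eq_bigr => j _; rewrite mulrCA; congr (_ * _).
  rewrite /z mulrCA; congr (_ * _).
  by rewrite mulr_sumr; apply: eq_bigr => k _; exact: mulrA.
apply: le_trans
  (ler_sum _ (fun s _ => expR_convex_sum _ (z^~ s) wt_ge0 wt_sum1)) _.
rewrite exchange_big/= -[leRHS]mul1r -[X in X * _]wt_sum1 mulr_suml.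
apply: ler_sum => j _; rewrite -[leLHS]mulr_sumr; apply: ler_wpM2l => //.
apply: le_trans (sum_expR_signs_row _ _) _.
rewrite card_ord ler_wpM2l ?exprn_ge0// ler_expR ler_wpM2r ?invr_ge0//.
under eq_bigr do rewrite exprMn.
rewrite -mulr_sumr ler_wpM2l ?sqr_ge0// -KHjE.
exact: le_trans (KHj_le_KH _ _) KH_le.
Qed.

Definition sample {N n : nat} (s : {ffun 'I_N * 'I_n -> bool}) (i : 'I_N) :
    {ffun 'I_n -> bool} := [ffun j => s (i, j)].

Lemma sum_expR_rel_errors {R : realType} {N n : nat} (A : 'M[R]_n) (K u : R) :
  A^T = A -> possemidef A -> 0 < \tr A -> KH A <= K ->
  \sum_(s : {ffun 'I_N * 'I_n -> bool})
     expR (u * \sum_i rel_error A (sample s i))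
  <= 2 ^+ (N * n) * expR (N%:R * (u ^+ 2 * K / 2)).
Proof.
move=> A_sym A_psd trA_gt0 KH_le.
under eq_bigr do rewrite mulr_sumr expR_sum.
rewrite (sum_prod_rows (fun s => expR (u * rel_error A s))) card_ord.
rewrite mulnC exprM expRM_natl -exprMn; apply: lerXn2r; rewrite ?nnegrE.
- by apply: sumr_ge0 => s _; exact: expR_ge0.
- by rewrite mulr_ge0 ?exprn_ge0 ?expR_ge0.
- exact: sum_expR_rel_error.
Qed.

Definition accurate {R : realType} {N n : nat} (A : 'M[R]_n) (eps : R)
    (s : {ffun 'I_N * 'I_n -> bool}) : bool :=
  `|tr_hutchinson A (fun i => sign_vector R n (sample s i)) - \tr A|
    <= eps * \tr A.

Lemma accurateE {R : realType} {N n : nat} (A : 'M[R]_n) (eps : R)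
    (s : {ffun 'I_N * 'I_n -> bool}) :
  (0 < N)%N -> 0 < \tr A ->
  accurate A eps s = (`|\sum_i rel_error A (sample s i)| <= eps * N%:R).
Proof.
move=> N_gt0 trA_gt0; have N_gt0' : 0 < N%:R :> R by rewrite ltr0n.
rewrite /accurate /tr_hutchinson -mulr_suml sumrB sumr_const card_ord.
set S := \sum_i _.
have -> : N%:R^-1 * S - \tr A = (S - \tr A *+ N) / \tr A * (\tr A / N%:R).
  rewrite -mulr_natl; field; rewrite !gt_eqF//.
rewrite normrM [X in _ * X]gtr0_norm ?divr_gt0//.
by rewrite mulrA ler_pdivrMr// mulrAC ler_pM2r.
Qed.

(** The exponent [- u * eps * N + N * u ^ 2 * K / 2] of the Chernoff bound is
minimal at [u = eps / K].  With [K = N * eps ^ 2 / (2 * L)] and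
[L = ln (2 / delta)], this is [u = 2 * L / (N * eps)], and the minimum is [- L]:
each tail has at most the fraction [expR (- L) = delta / 2] of all patterns. *)
Lemma card_inaccurate_le {R : realType} {N n : nat} (A : 'M[R]_n)
    (eps delta : R) :
  (0 < N)%N -> A^T = A -> possemidef A -> 0 < \tr A ->
  0 < eps -> 0 < delta -> delta < 1 ->
  N%:R > 2 * KH A * eps ^- 2 * ln (2 / delta) ->
  #|[pred s : {ffun 'I_N * 'I_n -> bool} | ~~ accurate A eps s]|%:R
    <= delta * 2 ^+ (N * n).
Proof.
move=> N_gt0 A_sym A_psd trA_gt0 eps_gt0 delta_gt0 delta_lt1 N_large.
have N_gt0' : 0 < N%:R :> R by rewrite ltr0n.
set L := ln (2 / delta) in N_large.
have L_gt0 : 0 < L by rewrite ln_gt0// ltr_pdivlMr//; lra.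
pose K := N%:R * eps ^+ 2 / (2 * L).
have KH_le : KH A <= K.
  rewrite /K ler_pdivlMr ?mulr_gt0// -ler_pdivrMr ?exprn_gt0//.
  apply: ltW; apply: le_lt_trans N_large.
  by rewrite [leLHS](_ : _ = 2 * KH A * eps ^- 2 * L)//; ring.
pose u := 2 * L / (N%:R * eps).
have u_ge0 : 0 <= u by rewrite divr_ge0 ?mulr_ge0 ?ltW.
(* Stated for v because the two tails need v = u and v = - u. *)
have tail (v : R) : v ^+ 2 = u ^+ 2 ->
    expR (- (u * (eps * N%:R))) *
    (\sum_(s : {ffun 'I_N * 'I_n -> bool})
       expR (v * \sum_i rel_error A (sample s i)))
    <= delta / 2 * 2 ^+ (N * n).
  move=> vu.
  have mgf_le := @sum_expR_rel_errors _ N _ _ _ v A_sym A_psd trA_gt0 KH_le.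
  apply: (le_trans (ler_wpM2l (expR_ge0 _) mgf_le)).
  rewrite mulrCA mulrC -expRD vu ler_wpM2r ?exprn_ge0//.
  have -> : - (u * (eps * N%:R)) + N%:R * (u ^+ 2 * K / 2) = - L.
    by rewrite /u /K; field; rewrite !gt_eqF.
  by rewrite expRN /L lnK ?invf_div// posrE divr_gt0.
pose up := [pred s : {ffun 'I_N * 'I_n -> bool} |
  eps * N%:R < \sum_i rel_error A (sample s i)].
pose dn := [pred s : {ffun 'I_N * 'I_n -> bool} |
  eps * N%:R < - \sum_i rel_error A (sample s i)].
have : (#|[pred s : {ffun 'I_N * 'I_n -> bool} | ~~ accurate A eps s]| <=
        #|up| + #|dn|)%N.
  rewrite -cardUI; apply: leq_trans (leq_addr _ _).
  apply: subset_leq_card; apply/fintype.subsetP => s.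
  rewrite !inE accurateE// -ltNge.
  by rewrite ltr_normr.
rewrite -(ler_nat R) natrD => /le_trans; apply.
have -> : delta * 2 ^+ (N * n) =
    delta / 2 * 2 ^+ (N * n) + delta / 2 * 2 ^+ (N * n) by field.
apply: lerD.
  apply: le_trans (card_gt_le_expR _ _ _ u_ge0) _; exact: tail.
apply: le_trans (card_gt_le_expR _ _ _ u_ge0) _.
under eq_bigr do rewrite mulrN -mulNr.
by apply: tail; rewrite sqrrN.
Qed.

(** * From sign patterns to the probability space *)

Lemma measurable_hutchinson_event {R : realType} {d : measure_display}
    {T : measurableType d} {N n : nat} (A : 'M[R]_n) (a : R)
    (x : 'I_N -> 'I_n -> T -> R) :
  (forall i j, measurable_fun setT (x i j)) ->
  measurable [set t | `|tr_hutchinson A (fun i => \col_j x i j t) - \tr A|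
                      <= a].
Proof.
move=> x_meas.
pose f t := tr_hutchinson A (fun i => \col_j x i j t).
have f_meas : measurable_fun setT f.
  rewrite (_ : f = fun t => N%:R^-1 *
      \sum_i \sum_j (x i j t * \sum_k A k j * x i k t)); last first.
    apply/funext => t; rewrite /f /tr_hutchinson; congr (_ * _).
    apply: eq_bigr => i _; rewrite quad_formE; apply: eq_bigr => j _.
    rewrite mxE; congr (_ * _); apply: eq_bigr => k _.
    by rewrite mxE.
  apply: measurable_funM => //; apply: measurable_sum => i.
  apply: measurable_sum => j; apply: measurable_funM => //.
  by apply: measurable_sum => k; exact: measurable_funM.
rewrite -[X in measurable X]setTI.
apply: measurable_fun_le => //.
by apply: measurableT_comp => //; exact: measurable_funB.
Qed.

Definition sign_event {R : realType} {d : measure_display}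
    {T : measurableType d} {P : probability T R} {I : finType}
    (X : I -> {RV P >-> R}) (s : {ffun I -> bool}) : set T :=
  \bigcap_(i in [set` [set: I]%SET]) (X i @^-1` [set (-1) ^+ s i]).

Lemma sign_eventP {R : realType} {d : measure_display}
    {T : measurableType d} {P : probability T R} {I : finType}
    (X : I -> {RV P >-> R}) (s : {ffun I -> bool}) (t : T) :
  sign_event X s t <-> forall i, X i t = (-1) ^+ s i.
Proof.
split=> [st i|st i _]; last exact: st.
by apply: st; rewrite /= inE.
Qed.

Lemma measurable_sign_event {R : realType} {d : measure_display}
    {T : measurableType d} {P : probability T R} {I : finType}
    (X : I -> {RV P >-> R}) (s : {ffun I -> bool}) :
  measurable (sign_event X s).
Proof.
apply: fin_bigcap_measurable => [|i _]; first exact: finite_finset.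
exact: measurable_funPTI.
Qed.

Lemma trivIset_sign_event {R : realType} {d : measure_display}
    {T : measurableType d} {P : probability T R} {I : finType}
    (X : I -> {RV P >-> R}) (D : set {ffun I -> bool}) :
  trivIset D (sign_event X).
Proof.
move=> s s' _ _ [t [/sign_eventP st /sign_eventP s't]]; apply/ffunP => i.
by apply/(@signr_inj R); rewrite -st -s't.
Qed.

Lemma prob_sign_event {R : realType} {d : measure_display}
    {T : measurableType d} {P : probability T R} {I : finType}
    (X : I -> {RV P >-> R}) (s : {ffun I -> bool}) :
  mutually_independent X -> (forall i, rademacher (X i)) ->
  P (sign_event X s) = (2 ^- #|I|)%:E.
Proof.
move=> X_indep X_rad; rewrite X_indep//; under eq_bigr => i _.
  rewrite (_ : P _ = (2^-1)%:E); last first.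
    by have [] := X_rad i; case: (s i) => /=; rewrite ?expr1 ?expr0.
  over.
by rewrite prodEFin prodr_const cardsT -exprVn.
Qed.

(** [G] contains the disjoint events of the good patterns, each of probability
[2 ^- #|I|]. *)
Lemma prob_ge_of_sign_events {R : realType} {d : measure_display}
    {T : measurableType d} {P : probability T R} {I : finType}
    (X : I -> {RV P >-> R}) (good : pred {ffun I -> bool}) (G : set T) :
  mutually_independent X -> (forall i, rademacher (X i)) -> measurable G ->
  (forall s t, good s -> (forall i, X i t = (-1) ^+ s i) -> G t) ->
  ((1 - #|[pred s | ~~ good s]|%:R / 2 ^+ #|I|)%:E <= P G)%E.
Proof.
move=> X_indep X_rad G_meas goodG.
have sub : \bigcup_(s in [set` good]) sign_event X s `<=` G.
  by move=> t [s /= gs /sign_eventP]; exact: goodG.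
apply: (@le_trans _ _ (P (\bigcup_(s in [set` good]) sign_event X s))).
  rewrite measure_fin_bigcup//; last first.
  - by move=> s _; exact: measurable_sign_event.
  - exact: trivIset_sign_event.
  rewrite -(@bigfs _ _ _ _ (index_enum _)) ?index_enum_uniq//; last first.
    by move=> s _; rewrite mem_index_enum.
  rewrite (eq_bigr (fun=> (2 ^- #|I|)%:E)); last first.
    by move=> s _; exact: prob_sign_event.
  have card_good : #|good|%:R + #|[pred s | ~~ good s]|%:R = 2 ^+ #|I| :> R.
    by rewrite -natrD cardC card_ffun card_bool natrX.
  rewrite sumEFin lee_fin big_const iter_addr_0 -[leRHS]mulr_natl.
  rewrite lerBlDr -mulrDl.
  by rewrite card_good divff// expf_neq0.
apply: le_measure => //; rewrite inE//; apply: fin_bigcup_measurable => //.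
by move=> s _; exact: measurable_sign_event.
Qed.

(** * The sample size bound *)

Theorem theorem2 (R : realType) (d : measure_display) (T : measurableType d)
    (P : probability T R) (n N : nat) (A : 'M[R]_n) (eps delta : R)
    (w : 'I_N -> 'I_n -> {RV P >-> R})
    (n_gt0 : (0 < n)%N) (N_gt0 : (0 < N)%N)
    (A_sym : A^T = A) (A_psd : possemidef A)
    (eps_gt0 : 0 < eps) (eps_lt1 : eps < 1)
    (delta_gt0 : 0 < delta) (delta_lt1 : delta < 1)
    (w_indep : mutually_independent
                 (fun ij : 'I_N * 'I_n => w ij.1 ij.2))
    (w_rademacher : forall i j, rademacher (w i j))
    (N_large : N%:R > 2 * KH A * eps ^- 2 * ln (2 / delta)) :
  (P [set t | (`|tr_hutchinson A (fun i => \col_j w i j t) - \tr A|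
               <= eps * \tr A)%R] >= (1 - delta)%:E)%E.
Proof.
set G := [set t | _].
have G_meas : measurable G.
  exact: (measurable_hutchinson_event A _ (fun i j => w i j)).
have trA_ge0 : 0 <= \tr A by apply: sumr_ge0 => j _; exact: possemidef_diag_ge0.
(* Relative errors make sense only for a nonzero trace. *)
have [trA0|trA_neq0] := eqVneq (\tr A) 0.
  have -> : G = setT.
    apply/seteqP; split=> // t _; rewrite /G /= trA0 mulr0 subr0 normr_le0.
    rewrite (possemidef_tr0 _ A_sym A_psd trA0) /tr_hutchinson.
    by rewrite big1 ?mulr0// => i _; rewrite mulmx0 mul0mx mxE.
  by rewrite probability_setT lee_fin gerBl ltW.
have trA_gt0 : 0 < \tr A by rewrite lt_neqAle eq_sym trA_neq0.
apply: le_trans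
  (prob_ge_of_sign_events _ (accurate A eps) _ w_indep _ G_meas _).
- rewrite lee_fin lerD2l lerN2 ler_pdivrMr ?exprn_gt0//.
  rewrite card_prod !card_ord; exact: card_inaccurate_le.
- by move=> ij; exact: w_rademacher.
- move=> s t; rewrite /accurate /G /= => acc wt.
  rewrite (_ : (fun i => \col_j w i j t) =
               (fun i => sign_vector R n (sample s i)))//.
  apply/funext => i; apply/matrixP => j k; rewrite !mxE ffunE.
  exact: (wt (i, j)).
Qed.
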